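(* Let $P_n$ denote the path with $n$ edges (and $n+1$ vertices), let $s=\frac{17+\sqrt{97}}{32}$ and $t=\frac{17-\sqrt{97}}{32}$, and let $$c=\frac{q(P_2)-q(P_1)\cdot t}{s(s-t)}.$$ Then, for every $n\geq 1$, $$q(P_n)=c\,s^{n}+(1-c)\,t^{n}\approx 1.16\cdot s^{n}-0.16\cdot t^{n},$$ where in the last expression the coefficients $c$ and $1-c$ are rounded to two decimal places.
   Context: For a finite simple graph $G=(V,E)$, associate a variable $x_v$ over $\mathbb{F}_2$ with each vertex $v$. A randomly generated system on $G$ has, for each edge $vw\in E$, one equation $f_{vw}(x_v,x_w)=0$, where the $f_{vw}$ are chosen independently and uniformly at random among all $16$ Boolean polynomials over $\mathbb{F}_2$ in the two variables $x_v,x_w$ (equivalently, all functions $\mathbb{F}_2^2\to\mathbb{F}_2$). $q(G)$ denotes the probability that this system is consistent, i.e. has a solution in $\mathbb{F}_2^{V}$. *)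

(* Defs.v *)
From HB Require Import structures.
From mathcomp Require Import all_boot all_order all_algebra.

Set Implicit Arguments.
Unset Strict Implicit.
Unset Printing Implicit Defensive.

Import GRing.Theory.
Local Open Scope ring_scope.

Record sgraph := SGraph {
  vertex :> finType;
  adj : rel vertex;
  adj_sym : symmetric adj;
  adj_irr : irreflexive adj }.

(* Each undirected edge {v, w} is represented once, as the pair (v, w) in which
   v comes before w in the enumeration of the vertex type. This only fixes which
   endpoint is the first argument of f_vw; the uniform law on the functions f_vw
   is invariant under exchanging the two arguments. *)
Definition edge (G : sgraph) : finType :=
  {e : G * G | adj e.1 e.2 && (enum_rank e.1 < enum_rank e.2)%N}.

(* Boolean polynomials in two variables, i.e. all 16 functions F_2^2 -> F_2. *)
Definition bpoly2 : finType := {ffun 'F_2 * 'F_2 -> 'F_2}.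

Definition system (G : sgraph) : finType := {ffun edge G -> bpoly2}.

Definition consistent (G : sgraph) (f : system G) : bool :=
  [exists x : {ffun G -> 'F_2},
    [forall e : edge G, f e (x (val e).1, x (val e).2) == 0]].

(* Probability of consistency: by independence and uniformity of the f_e, a
   system has probability the product over the edges e of 1 / #|bpoly2|. *)
Definition q (R : numFieldType) (G : sgraph) : R :=
  \sum_(f : system G | consistent f) \prod_(e : edge G) (#|bpoly2|%:R)^-1.

Definition path_adj (n : nat) : rel 'I_n.+1 :=
  fun i j => (i.+1 == j :> nat) || (j.+1 == i :> nat).

Lemma path_adj_sym n : symmetric (@path_adj n).
Proof. by move=> i j; rewrite /path_adj orbC. Qed.

Lemma path_adj_irr n : irreflexive (@path_adj n).
Proof. by move=> i; rewrite /path_adj orbb eqn_leq ltnn. Qed.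

(* n counts the edges: there are n + 1 vertices. *)
Definition path_graph (n : nat) : sgraph :=
  SGraph (@path_adj_sym n) (@path_adj_irr n).

(* Main.v *)
(** Process the path from one end, recording the set of values of the current
    vertex that extend to a solution of the equations met so far. A uniform
    equation sends a one-element set to the empty set, a one-element set and the
    full set in 4, 8 and 4 of the 16 cases, and the full set in 1, 6 and 9 cases.
    So the consistent systems are counted by the powers of the matrix
    [[8, 4], [6, 9]], whose eigenvalues are 16 s and 16 t. The two
    coefficients add up to 1 since q(P_0) = 1, and that of s^n is
    c = (13 + sqrt 97) / (2 sqrt 97). *)

Require Import Defs.
From mathcomp Require Import all_boot all_order all_algebra.
From mathcomp Require Import zify ring lra.
Import Order.TTheory GRing.Theory Num.Theory.
Local Open Scope ring_scope.

Lemma F2_cases (x : 'F_2) : x = 0 \/ x = 1.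
Proof. by case: x => [[|[|m]] lt_m]; [left|right|by []]; exact: val_inj. Qed.

(* A pair of booleans [S] encodes the set of values containing 0 iff [S.1] and
   1 iff [S.2]. *)
Definition in_state (S : bool * bool) (x : 'F_2) : bool :=
  if x == 0 then S.1 else S.2.

(** The image of the set [S] under the relation [h (x, y) = 0]. *)
Definition step (S : bool * bool) (h : bpoly2) : bool * bool :=
  (S.1 && (h (0, 0) == 0) || S.2 && (h (1, 0) == 0),
   S.1 && (h (0, 1) == 0) || S.2 && (h (1, 1) == 0)).

Fixpoint solvable (S : bool * bool) (g : seq bpoly2) : bool :=
  if g is h :: g' then solvable (step S h) g' else S.1 || S.2.

Lemma in_stepP (S : bool * bool) (h : bpoly2) (y : 'F_2) :
  reflect (exists2 x, in_state S x & h (x, y) = 0) (in_state (step S h) y).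
Proof.
rewrite /in_state /step; apply: (iffP idP) => [|[x]].
  by case: (F2_cases y) => -> /= /orP[] /andP[Sx /eqP hx];
     [exists 0|exists 1|exists 0|exists 1].
by case: (F2_cases x) (F2_cases y) => -> [] -> /= -> ->; rewrite eqxx ?orbT.
Qed.

(** Indexing assignments by [nat] lets the induction on [g] prepend or drop the value at the first
    vertex by a plain shift. The bound on [i] keeps [nth] away from its default. *)
Lemma solvableP (S : bool * bool) (g : seq bpoly2) :
  reflect (exists2 x : nat -> 'F_2, in_state S (x 0%N) &
             forall i, (i < size g)%N -> nth [ffun=> 0] g i (x i, x i.+1) = 0)
          (solvable S g).
Proof.
elim: g S => [|h g IHg] S /=.
  apply: (iffP idP) => [/orP[S0|S1]|[x]]; first by exists (fun=> 0).
    by exists (fun=> 1).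
  by rewrite /in_state; case: ifP => _ ->; rewrite ?orbT.
apply: (iffP (IHg _)) => [[x /in_stepP[a Sa ha] xg]|[x Sx xg]].
  by exists (fun i => if i is j.+1 then x j else a) => // -[|i] //; apply: xg.
exists (fun i => x i.+1) => [|i]; last exact: (xg i.+1).
by apply/in_stepP; exists (x 0%N) => //; apply: (xg 0%N).
Qed.

Fact path_edge_subproof {n : nat} (i : 'I_n) :
  let e := (widen_ord (leqnSn n) i, lift ord0 i) in
  adj (s := path_graph n) e.1 e.2 && (enum_rank e.1 < enum_rank e.2)%N.
Proof. by rewrite /= /path_adj !enum_rank_ord /= /bump /= add1n eqxx ltnS leqnn. Qed.

Definition path_edge {n : nat} (i : 'I_n) : edge (path_graph n) := 
  exist (fun e : path_graph n * path_graph n =>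
           is_true (adj e.1 e.2 && (enum_rank e.1 < enum_rank e.2)%N))
        _ (path_edge_subproof i).

(** On ordinals [enum_rank] respects the order, so each edge is represented by its increasing
    pair. *)
Lemma edge_path_succ {n : nat} (e : edge (path_graph n)) :
  (val e).2 = (val e).1.+1 :> nat.
Proof.
case: e => -[a b] /= /andP[]; rewrite /path_adj !enum_rank_ord /=.
by case/orP=> /eqP <- //; rewrite ltnNge leqnSn.
Qed.

Fact edge_start_subproof {n : nat} (e : edge (path_graph n)) : ((val e).1 < n)%N.
Proof. by rewrite -ltnS -edge_path_succ. Qed.

Definition edge_start {n : nat} (e : edge (path_graph n)) : 'I_n :=
  Ordinal (edge_start_subproof e).

Lemma path_edgeK (n : nat) : cancel (@path_edge n) edge_start.
Proof. by move=> i; apply: val_inj. Qed.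

Lemma edge_startK (n : nat) : cancel (@edge_start n) path_edge.
Proof.
move=> e; apply: val_inj; rewrite [RHS]surjective_pairing /=.
by congr pair; apply: val_inj => //=; rewrite edge_path_succ.
Qed.

Lemma card_edge_path (n : nat) : #|edge (path_graph n)| = n.
Proof. by rewrite (bij_eq_card (Bijective (@edge_startK n) (@path_edgeK n))) card_ord. Qed.

Definition tuple_system {n : nat} (g : n.-tuple bpoly2) : system (path_graph n) :=
  [ffun e => tnth g (edge_start e)].

Lemma tuple_system_bij (n : nat) : bijective (@tuple_system n).
Proof.
exists (fun f : system _ => [tuple f (path_edge i) | i < n]) => [g|f].
  by apply: eq_from_tnth => i; rewrite tnth_mktuple ffunE path_edgeK.
by apply/ffunP => e; rewrite ffunE tnth_mktuple edge_startK.
Qed.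

Lemma consistent_tuple (n : nat) (g : n.-tuple bpoly2) :
  consistent (tuple_system g) = solvable (true, true) g.
Proof.
apply/existsP/solvableP => [[x /forallP xg]|[x _ xg]].
  (* Only indices up to [n] occur in the equations, so [inord] never falls back on its default
     there. *)
  exists (fun i => x (inord i)) => [|i]; first by rewrite /in_state; case: ifP.
  rewrite size_tuple => lt_in; have /eqP := xg (path_edge (Ordinal lt_in)).
  rewrite ffunE path_edgeK (tnth_nth [ffun=> 0]) /= => xgi; rewrite -[RHS]xgi.
  by congr (_ (x _, x _)); apply: ord_inj; rewrite /= inordK // ltnW.
exists [ffun i : 'I_n.+1 => x i]; apply/forallP => e.
rewrite !ffunE (tnth_nth [ffun=> 0]) edge_path_succ xg //.
by rewrite size_tuple ltn_ord.
Qed.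

(** An arbitrary initial state makes the count closed under removal of the first equation. *)
Definition solvable_count (n : nat) (S : bool * bool) : nat :=
  \sum_(g : n.-tuple bpoly2) solvable S g.

Lemma card_bpoly2 : #|bpoly2| = 16%N.
Proof. by rewrite card_ffun card_prod card_Fp. Qed.

Lemma q_path (R : numFieldType) (n : nat) :
  q R (path_graph n) = (solvable_count n (true, true))%:R / 16 ^+ n.
Proof.
rewrite /q (reindex _ (onW_bij _ (tuple_system_bij n))) /=.
under eq_bigl do rewrite consistent_tuple.
under eq_bigr do rewrite prodr_const card_edge_path card_bpoly2.
rewrite big_mkcond /= natr_sum mulr_suml; apply: eq_bigr => g _.
by case: solvable; rewrite ?mul0r // mul1r exprVn.
Qed.

(** A function into ['F_2] is determined by its zero set, here four independent booleans. *)
Lemma sum_bpoly2 (F : bool -> bool -> bool -> bool -> nat) :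
  (\sum_(h : bpoly2)
     F (h (0, 0) == 0)%R (h (0, 1) == 0)%R (h (1, 0) == 0)%R (h (1, 1) == 0)%R
   = \sum_(a : bool) \sum_(b : bool) \sum_(c : bool) \sum_(d : bool) F a b c d)%N.
Proof.
pose tab (u : bool * bool * (bool * bool)) : bpoly2 :=
  [ffun x => if (if x.1 == 0 then if x.2 == 0 then u.1.1 else u.1.2
                 else if x.2 == 0 then u.2.1 else u.2.2) then 0 else 1].
have tab_bij : bijective tab.
  exists (fun h : bpoly2 =>
    ((h (0, 0) == 0, h (0, 1) == 0), (h (1, 0) == 0, h (1, 1) == 0))) => [u|h].
    by case: u => [[a b] [c d]]; rewrite !ffunE /=; case: a b c d => [] [] [] [].
  apply/ffunP => -[x y]; rewrite ffunE /=.
  by case: (F2_cases x) (F2_cases y) => -> [] -> /=;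
     [case: (F2_cases (h (0, 0))) | case: (F2_cases (h (0, 1)))
     |case: (F2_cases (h (1, 0))) | case: (F2_cases (h (1, 1)))] => ->.
rewrite (reindex _ (onW_bij _ tab_bij)) /= !pair_bigA /=.
(* The nested sums flatten to left-nested quadruples, while [tab] takes a pair of rows. *)
rewrite (reindex (fun u : bool * bool * (bool * bool) => (u.1, u.2.1, u.2.2))) /=.
  apply: eq_bigr => -[[a b] [c d]] _; rewrite !ffunE /=.
  by case: a b c d => [] [] [] [].
by exists (fun v => (v.1.1, (v.1.2, v.2))) => [[? []]|[[]]].
Qed.

Lemma solvable_countS (n : nat) (S : bool * bool) :
  solvable_count n.+1 S = (\sum_(h : bpoly2) solvable_count n (step S h))%N.
Proof.
rewrite /solvable_count pair_bigA /=.
rewrite (reindex (fun u : bpoly2 * n.-tuple bpoly2 => cons_tuple u.1 u.2)) //=.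
exists (fun g : n.+1.-tuple bpoly2 => (thead g, behead_tuple g)) => [[h g] _|g _] /=.
  by rewrite theadE; congr pair; apply: val_inj.
by rewrite [RHS]tuple_eta; apply: val_inj.
Qed.

Lemma solvable_count0 (S : bool * bool) : solvable_count 0 S = (S.1 || S.2).
Proof.
rewrite /solvable_count (big_pred1 [tuple]) // => g.
by rewrite [g]tuple0 /= eqxx.
Qed.

Lemma solvable_count_step (n : nat) (p r : bool) :
  solvable_count n.+1 (p, r) =
  (\sum_(a : bool) \sum_(b : bool) \sum_(c : bool) \sum_(d : bool)
     solvable_count n (p && a || r && c, p && b || r && d))%N.
Proof. by rewrite solvable_countS -sum_bpoly2. Qed.

Lemma solvable_count_empty (n : nat) : solvable_count n (false, false) = 0%N.
Proof.
elim: n => [|n IHn]; first by rewrite solvable_count0.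
by rewrite solvable_count_step !big_bool /= IHn.
Qed.

Lemma solvable_count_sym (n : nat) :
  solvable_count n (false, true) = solvable_count n (true, false).
Proof.
by case: n => [|n]; rewrite ?solvable_count0 // !solvable_count_step !big_bool /=; lia.
Qed.

Lemma solvable_count_single (n : nat) :
  solvable_count n.+1 (true, false) =
  (8 * solvable_count n (true, false) + 4 * solvable_count n (true, true))%N.
Proof.
rewrite solvable_count_step !big_bool /= solvable_count_empty.
by rewrite solvable_count_sym; lia.
Qed.

(** From the full set each value survives in 3 of 4 cases, independently of the other: 9 cases keep
    both and 3 + 3 keep exactly one. *)
Lemma solvable_count_full (n : nat) :
  solvable_count n.+1 (true, true) =
  (6 * solvable_count n (true, false) + 9 * solvable_count n (true, true))%N.
Proof.
rewrite solvable_count_step !big_bool /= solvable_count_empty.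
by rewrite solvable_count_sym; lia.
Qed.

(** Cayley-Hamilton for the matrix, of trace 17 and determinant 72 - 24 = 48, rescaled by powers of
    16. *)
Lemma q_path_rec (R : numFieldType) (n : nat) :
  q R (path_graph n.+2) =
  17 / 16 * q R (path_graph n.+1) - 3 / 16 * q R (path_graph n).
Proof.
have count_rec : (solvable_count n.+2 (true, true) + 48 * solvable_count n (true, true)
    = 17 * solvable_count n.+1 (true, true))%N.
  by rewrite 2!solvable_count_full solvable_count_single; lia.
have /(congr1 (GRing.natmul (1 : R))) := count_rec.
rewrite !q_path natrD !natrM !exprS => /(canRL (addrK _)) ->.
by field; rewrite expf_neq0 // pnatr_eq0.
Qed.

Lemma q_path0 (R : numFieldType) : q R (path_graph 0) = 1.
Proof. by rewrite q_path solvable_count0 divr1. Qed.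

Lemma q_path1 (R : numFieldType) : q R (path_graph 1) = 15 / 16.
Proof. by rewrite q_path solvable_count_full !solvable_count0. Qed.

Theorem theorem16 (R : rcfType) :
  let s : R := (17 + Num.sqrt 97) / 32 in
  let t : R := (17 - Num.sqrt 97) / 32 in
  let c : R := (q R (path_graph 2) - q R (path_graph 1) * t) / (s * (s - t)) in
  (forall n : nat, (1 <= n)%N ->
     q R (path_graph n) = c * s ^+ n + (1 - c) * t ^+ n)
  /\ `|c - 116 / 100| < 1 / 200
  /\ `|(1 - c) - (- (16 / 100))| < 1 / 200.
Proof.
move=> s t c.
set w : R := Num.sqrt 97 in s t c *.
have w2 : w * w = 97 by rewrite -expr2 sqr_sqrtr ?ler0n.
have w_ge0 : 0 <= w by rewrite sqrtr_ge0.
(* The squares of 9.8 and 9.9 are 96.04 and 98.01. *)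
have w_lo : 98 / 10 < w by nra.
have w_hi : w < 99 / 10 by nra.
have w_neq0 : w != 0 by rewrite gt_eqF //; lra.
have cE : c = 1 / 2 + 13 / 2 / w.
  rewrite /c; have -> : q R (path_graph 2) = 17 / 16 * (15 / 16) - 3 / 16.
    by rewrite q_path_rec q_path1 q_path0 mulr1.
  rewrite q_path1; apply: (canLR (mulfK _)).
    by rewrite mulf_neq0 // gt_eqF // /s /t; lra.
  have -> : s - t = w / 16 by rewrite /s /t; field.
  by rewrite /s /t; field: w2.
have closed_form n : q R (path_graph n) = c * s ^+ n + (1 - c) * t ^+ n.
  (* The recurrence has order two, so the induction carries two consecutive values, starting from
     [n = 0]. *)
  suff [] : q R (path_graph n) = c * s ^+ n + (1 - c) * t ^+ n /\
            q R (path_graph n.+1) = c * s ^+ n.+1 + (1 - c) * t ^+ n.+1 by [].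
  elim: n => [|n [IHn IHn1]].
    rewrite q_path0 q_path1 !expr0 !expr1 cE; split; first by ring.
    by rewrite /s /t; field.
  split=> //; rewrite q_path_rec IHn1 IHn.
  (* Both [s] and [t] are roots of the characteristic polynomial of the recurrence. *)
  have s2 : s * s = 17 / 16 * s - 3 / 16 by rewrite /s; lra.
  have t2 : t * t = 17 / 16 * t - 3 / 16 by rewrite /t; lra.
  by rewrite !exprS !(mulrA s s) !(mulrA t t) s2 t2; ring.
(* Since [c] is affine in [w^-1], these bounds place it between 1.156 and 1.164. *)
have wV_lo : 10 / 99 < w^-1 by rewrite -invf_div ltf_pV2 ?posrE //; lra.
have wV_hi : w^-1 < 10 / 98 by rewrite -[ltRHS]invf_div ltf_pV2 ?posrE //; lra.
have c_bound : `|c - 116 / 100| < 1 / 200 by rewrite cE ltr_norml; lra.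
do 2!split=> //.
have -> : 1 - c - - (16 / 100) = - (c - 116 / 100) by lra.
by rewrite normrN.
Qed.
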